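(* Let $K=K(p/q)\subset S^3$ be a 2-bridge knot, let $B^3\subset S^3$ be the 3-ball meeting $K$ in the pair of unknotted arcs $A_1\cup A_2$ at the end of the diagram (as described in the context), and set $(Y_0,K_0)=(S^3\setminus B^3,K\setminus(A_1\cup A_2))$. Then the space $R(Y_0,K_0)$ is an arc, and the restriction map $R(Y_0,K_0)\to R(S^2,\{a,b,c,d\})$ is the embedding $$(\gamma,\theta)=(qt,(q-p)t),\quad t\in[0,\pi].$$
   Context: Notation. $SU(2)$ is identified with the unit quaternions; $C(\mathbf i)$ is the set of pure (traceless) unit quaternions; $e^{tQ}=\cos t+\sin t\,Q$ for $Q\in C(\mathbf i)$. Pillowcase. $R(S^2,\{a,b,c,d\})$ is the space of conjugacy classes of homomorphisms $\langle a,b,c,d\mid ba=cd\rangle\to SU(2)$ sending each generator into $C(\mathbf i)$. It is identified with $\mathbb{R}^2/\sim$, where $(\gamma,\theta)\sim(-\gamma,-\theta)\sim(\gamma+2\pi m,\theta+2\pi n)$ for $m,n\in\mathbb{Z}$, by letting $(\gamma,\theta)$ correspond to the class of $a\mapsto\mathbf i,\ b\mapsto e^{\gamma\mathbf k}\mathbf i,\ c\mapsto e^{\theta\mathbf k}\mathbf i,\ d\mapsto e^{(\theta-\gamma)\mathbf k}\mathbf i$. Curves are described by lifts to $\mathbb{R}^2$. The knot and tangle. Let $a_1,\dots,a_m$ be integers, $m$ odd, with $\frac pq=a_1+\cfrac{1}{a_2+\cfrac{1}{\ddots+\frac1{a_m}}}$, where $p,q$ are relatively prime and $p$ is odd. $K(p/q)$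 is the 2-bridge knot given by the standard diagram with twist regions $a_1,\dots,a_m$ (Burde–Zieschang conventions; its 2-fold branched cover is $L(p,q)$, oriented as a quotient of $S^3$). The ball $B^3$ contains a trivial tangle adjacent to the $a_1$ twist region, and $K_0\subset Y_0$ is the rational tangle obtained from a trivial tangle (joining the $b$ and $c$ ends, and the $a$ and $d$ ends) by adding $a_m,a_{m-1},\dots,a_1$ half twists, alternately to the $(c,d)$ ends and the $(b,c)$ ends. $R(Y_0,K_0)$ is the space of conjugacy classes of homomorphisms $\pi_1(Y_0\setminus K_0)\to SU(2)$ sending the meridians of $K_0$ into $C(\mathbf i)$. Explicitly: $\pi_1(Y_0\setminus K_0)$ is free on meridians $u,v$ of the two components of $K_0$, so such a homomorphism is an arbitrary pair $(U,V)\in C(\mathbf i)^2$ of images of $(u,v)$. The images of the boundary meridians $(a,b,c,d)$ are obtained from $(U,V,V,U)$ as follows: on quadruples of pure unit quaternions let $T_{cd}(a,b,c,d)=(a,b,cdc^{-1},c)$ and $T_{bc}(a,b,c,d)=(a,bcb^{-1},b,d)$ (both invertible); then $$(a,b,c,d)=T_{cd}^{-a_1}T_{bc}^{a_2}T_{cd}^{-a_3}\cdots T_{bc}^{a_{m-1}}T_{cd}^{-a_m}(U,V,V,U).$$ The restriction map sends the class of $(U,V)$ to the class of this quadruple. *)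

(* Defs.v *)
From HB Require Import structures.
From mathcomp Require Import all_boot all_order all_algebra ring.
From mathcomp Require Import all_classical reals topology normedtype trigo.

Set Implicit Arguments.
Unset Strict Implicit.
Unset Printing Implicit Defensive.

Import Order.TTheory GRing.Theory Num.Theory.
Import numFieldNormedType.Exports.

Local Open Scope classical_set_scope.
Local Open Scope ring_scope.
Local Open Scope quotient_scope.

Section Topology.
Context {X Y : topologicalType}.

Definition homeomorphism (f : X -> Y) : Prop :=
  continuous f /\
  exists2 g : Y -> X, continuous g & cancel f g /\ cancel g f.

(* a homeomorphism onto the image: the topology of X is the one induced by f *)
Definition embedding (f : X -> Y) : Prop :=
  [/\ continuous f, injective f &
      forall U : set X, open U -> exists2 V : set Y, open V & f @^-1` V = U].

End Topology.

Definition is_arc (R : realType) (X : topologicalType) : Prop :=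
  exists f : (`[0, 1]%classic : set R) -> X, homeomorphism f.

(* The continued fraction a_1 + 1/(a_2 + 1/(... + 1/a_m)), with values in
   rat together with the point [None] at infinity and the conventions
   1/0 = oo, 1/oo = 0, a + oo = oo; so no partial denominator is required
   to be nonzero. The empty fraction is oo, hence [:: a] has value a. *)
Definition ratinf_inv (x : option rat) : option rat :=
  if x is Some r then (if r == 0 then None else Some r^-1) else Some 0.

Definition ratinf_add (a : int) (x : option rat) : option rat :=
  if x is Some r then Some (a%:~R + r) else None.

Definition cfrac (a : seq int) : option rat :=
  foldr (fun a_i x => ratinf_add a_i (ratinf_inv x)) None a.

Definition ratinf_frac (p q : int) : option rat :=
  if q == 0 then None else Some (p%:~R / q%:~R).

Section Quaternions.
Context {R : realType}.

(* (x0, x1, x2, x3) is x0 + x1 i + x2 j + x3 k *)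
Local Notation quat := (R * R * R * R)%type.
Implicit Types x y z : quat.

Definition qre x : R := x.1.1.1.

Definition qone : quat := (1, 0, 0, 0).

Definition qmul x y : quat :=
  let: (x0, x1, x2, x3) := x in
  let: (y0, y1, y2, y3) := y in
  (x0 * y0 - x1 * y1 - x2 * y2 - x3 * y3,
   x0 * y1 + x1 * y0 + x2 * y3 - x3 * y2,
   x0 * y2 - x1 * y3 + x2 * y0 + x3 * y1,
   x0 * y3 + x1 * y2 - x2 * y1 + x3 * y0).

Definition qconj x : quat :=
  let: (x0, x1, x2, x3) := x in (x0, - x1, - x2, - x3).

Definition qnorm2 x : R :=
  let: (x0, x1, x2, x3) := x in x0 ^+ 2 + x1 ^+ 2 + x2 ^+ 2 + x3 ^+ 2.

Lemma qmulA : associative qmul.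
Proof.
move=> [[[? ?] ?] ?] [[[? ?] ?] ?] [[[? ?] ?] ?] /=.
by congr (_, _, _, _); ring.
Qed.

Lemma qmul1 : left_id qone qmul.
Proof. by move=> [[[? ?] ?] ?] /=; congr (_, _, _, _); ring. Qed.

Lemma qmulr1 : right_id qone qmul.
Proof. by move=> [[[? ?] ?] ?] /=; congr (_, _, _, _); ring. Qed.

Lemma qconjM x : qmul (qconj x) x = (qnorm2 x, 0, 0, 0).
Proof.
by case: x => [[[? ?] ?] ?]; rewrite /qmul /qconj /qnorm2;
  congr (_, _, _, _); ring.
Qed.

Lemma qconjMr x : qmul x (qconj x) = (qnorm2 x, 0, 0, 0).
Proof.
by case: x => [[[? ?] ?] ?]; rewrite /qmul /qconj /qnorm2;
  congr (_, _, _, _); ring.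
Qed.

Lemma qnorm2M x y : qnorm2 (qmul x y) = qnorm2 x * qnorm2 y.
Proof. by case: x => [[[? ?] ?] ?]; case: y => [[[? ?] ?] ?] /=; ring. Qed.

Lemma qnorm2_conj x : qnorm2 (qconj x) = qnorm2 x.
Proof. by case: x => [[[? ?] ?] ?] /=; ring. Qed.

Lemma qre_mulC x y : qre (qmul x y) = qre (qmul y x).
Proof.
by case: x => [[[? ?] ?] ?]; case: y => [[[? ?] ?] ?]; rewrite /qre /=; ring.
Qed.

End Quaternions.

Section UnitQuaternions.
Context (R : realType).

Definition SU2 : Type := [set x : R * R * R * R | qnorm2 x = 1]%classic.

HB.instance Definition _ := Topological.on SU2.

Implicit Types x y z : SU2.

Definition mkSU2 (q : R * R * R * R) (qP : qnorm2 q = 1) : SU2 :=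
  SigSub (mem_set (qP : [set x | qnorm2 x = 1] q)).

Lemma SU2P x : qnorm2 (\val x) = 1. Proof. exact: set_mem (valP x). Qed.

Fact SU2_one_subproof : qnorm2 (@qone R) = 1.
Proof. by rewrite /qone /=; ring. Qed.
Fact SU2_mul_subproof x y : qnorm2 (qmul (\val x) (\val y)) = 1.
Proof. by rewrite qnorm2M !SU2P mulr1. Qed.
Fact SU2_inv_subproof x : qnorm2 (qconj (\val x)) = 1.
Proof. by rewrite qnorm2_conj SU2P. Qed.

Definition SU2_one : SU2 := mkSU2 SU2_one_subproof.
Definition SU2_mul x y : SU2 := mkSU2 (SU2_mul_subproof x y).
Definition SU2_inv x : SU2 := mkSU2 (SU2_inv_subproof x).

Fact SU2_mulA : associative SU2_mul.
Proof. by move=> x y z; apply/val_inj/qmulA. Qed.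
Fact SU2_mul1 : left_id SU2_one SU2_mul.
Proof. by move=> x; apply/val_inj/qmul1. Qed.
Fact SU2_mulr1 : right_id SU2_one SU2_mul.
Proof. by move=> x; apply/val_inj/qmulr1. Qed.
Fact SU2_mulV : left_inverse SU2_one SU2_inv SU2_mul.
Proof. by move=> x; apply/val_inj; rewrite /= qconjM SU2P. Qed.
Fact SU2_mulrV : right_inverse SU2_one SU2_inv SU2_mul.
Proof. by move=> x; apply/val_inj; rewrite /= qconjMr SU2P. Qed.

HB.instance Definition _ :=
  isGroup.Build SU2 SU2_mulA SU2_mul1 SU2_mulr1 SU2_mulV SU2_mulrV.

Lemma qre_mulgC x y : qre (\val (x * y)%g) = qre (\val (y * x)%g).
Proof. exact: qre_mulC. Qed.

Lemma val_SU2M x y : \val (x * y)%g = qmul (\val x) (\val y).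
Proof. by []. Qed.

(* C(i), the conjugacy class of i: the pure unit quaternions *)
Definition Ci : Type := [set x : SU2 | qre (\val x) = 0]%classic.

Definition mkCi x (xP : qre (\val x) = 0) : Ci :=
  SigSub (mem_set (xP : [set x : SU2 | qre (\val x) = 0] x)).

Lemma CiP (u : Ci) : qre (\val (\val u)) = 0. Proof. exact: set_mem (valP u). Qed.

Fact qi_subproof : qnorm2 (0, 1, 0, 0 : R) = 1. Proof. by rewrite /=; ring. Qed.
Fact qk_subproof : qnorm2 (0, 0, 0, 1 : R) = 1. Proof. by rewrite /=; ring. Qed.
Definition qi : Ci := @mkCi (mkSU2 qi_subproof) erefl.
Definition qk : Ci := @mkCi (mkSU2 qk_subproof) erefl.

Fact conjCi_subproof x (u : Ci) : qre (\val (x * \val u * x^-1)%g) = 0.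
Proof. by rewrite qre_mulgC mulKg CiP. Qed.

Definition conjCi x (u : Ci) : Ci := mkCi (conjCi_subproof x u).

(* e^(t u) = cos t + sin t u *)
Definition qexp_val (t : R) (u : Ci) : R * R * R * R :=
  let: (_, u1, u2, u3) := \val (\val u) in
  (cos t, sin t * u1, sin t * u2, sin t * u3).

Fact qexp_subproof (t : R) (u : Ci) : qnorm2 (qexp_val t u) = 1.
Proof.
rewrite /qexp_val; move: (CiP u) (SU2P (\val u)).
case: (\val (\val u)) => [[[u0 u1] u2] u3]; rewrite /qre /= => -> {u0} nu.
rewrite -(cos2Dsin2 t) -[in RHS](mulr1 (sin t ^+ 2)) -nu; ring.
Qed.

Definition qexp (t : R) (u : Ci) : SU2 := mkSU2 (qexp_subproof t u).

Fact qexpk_i_subproof (t : R) : qre (\val (qexp t qk * \val qi)%g) = 0.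
Proof. by rewrite /qre /= /qexp_val /=; ring. Qed.

Definition qexpk_i (t : R) : Ci := mkCi (qexpk_i_subproof t).

Lemma val_qexpk_i (t : R) : \val (\val (qexpk_i t)) = (0, cos t, sin t, 0).
Proof. by rewrite /= /qexp_val /=; congr (_, _, _, _); ring. Qed.

End UnitQuaternions.

Section RepresentationSpaces.
Context (R : realType).
Local Notation SU2 := (SU2 R).
Local Notation Ci := (Ci R).

(* The complement of the rational tangle K_0 has fundamental group free on the
   meridians u and v of the two components, so a homomorphism to SU(2) sending
   the meridians into C(i) is the pair (U, V) of images of (u, v). The way K_0
   sits in Y_0 only shows in the images of the boundary meridians, see
   [boundary]. *)
Definition pairY : Type := (Ci * Ci)%type.

Definition conj_pairY (g : SU2) (x : pairY) : pairY :=
  (conjCi g x.1, conjCi g x.2).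

(* A homomorphism < a, b, c, d | b a = c d > -> SU(2) sending the generators
   into C(i) is the quadruple of images of (a, b, c, d). *)
Definition quadruple : Type := (Ci * Ci * Ci * Ci)%type.

Definition conj_quad (g : SU2) (x : quadruple) : quadruple :=
  let: (a, b, c, d) := x in (conjCi g a, conjCi g b, conjCi g c, conjCi g d).

Definition quad_rel (x : quadruple) : Prop :=
  let: (a, b, c, d) := x in (\val b * \val a = \val c * \val d)%g.

Definition homS : Type := [set x : quadruple | quad_rel x]%classic.

Definition mkhomS (x : quadruple) (xP : quad_rel x) : homS :=
  SigSub (mem_set (xP : [set x | quad_rel x] x)).

Lemma homSP (x : homS) : quad_rel (\val x). Proof. exact: set_mem (valP x). Qed.

Lemma conjCi1 (u : Ci) : conjCi 1%g u = u.
Proof. by apply/val_inj; rewrite /= mul1g invg1 mulg1. Qed.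

Lemma conjCiM (g h : SU2) (u : Ci) : conjCi (g * h)%g u = conjCi g (conjCi h u).
Proof. by apply/val_inj; rewrite /= invgM !mulgA. Qed.

Lemma conj_pairY1 x : conj_pairY 1%g x = x.
Proof. by case: x => u v; rewrite /conj_pairY !conjCi1. Qed.
Lemma conj_pairYM g h x : conj_pairY (g * h)%g x = conj_pairY g (conj_pairY h x).
Proof. by rewrite /conj_pairY !conjCiM. Qed.
Lemma conj_quad1 x : conj_quad 1%g x = x.
Proof. by case: x => [[[a b] c] d]; rewrite /= !conjCi1. Qed.
Lemma conj_quadM g h x : conj_quad (g * h)%g x = conj_quad g (conj_quad h x).
Proof. by case: x => [[[a b] c] d]; rewrite /= !conjCiM. Qed.

Definition eqvY : rel pairY :=
  fun x y => `[< exists g : SU2, y = conj_pairY g x >].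
Definition eqvS : rel homS :=
  fun x y => `[< exists g : SU2, \val y = conj_quad g (\val x) >].

Fact eqvY_equiv : equiv_class_of eqvY.
Proof.
split.
- by move=> x; apply/asboolP; exists 1%g; rewrite conj_pairY1.
- move=> x y; apply/asboolP/asboolP => -[g ->]; exists g^-1%g;
    by rewrite -conj_pairYM mulVg conj_pairY1.
- move=> y x z /asboolP[g ->] /asboolP[h ->]; apply/asboolP; exists (h * g)%g.
  by rewrite conj_pairYM.
Qed.

Fact eqvS_equiv : equiv_class_of eqvS.
Proof.
split.
- by move=> x; apply/asboolP; exists 1%g; rewrite conj_quad1.
- move=> x y; apply/asboolP/asboolP => -[g gE]; exists g^-1%g;
    by rewrite gE -conj_quadM mulVg conj_quad1.
- move=> y x z /asboolP[g gE] /asboolP[h hE]; apply/asboolP; exists (h * g)%g.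
  by rewrite hE gE conj_quadM.
Qed.

Canonical eqvY_equiv_rel := EquivRelPack eqvY_equiv.
Canonical eqvS_equiv_rel := EquivRelPack eqvS_equiv.

(* R(Y_0, K_0), with the quotient topology *)
Definition RY : Type := quotient_topology {eq_quot eqvY}.

(* R(S^2, {a, b, c, d}), with the quotient topology *)
Definition RS : Type := quotient_topology {eq_quot eqvS}.

Lemma RY_eqP (x y : pairY) :
  \pi_RY x = \pi_RY y <-> exists g : SU2, y = conj_pairY g x.
Proof.
rewrite -[X in X <-> _]/(\pi_({eq_quot eqvY}) x = \pi_({eq_quot eqvY}) y).
have E := @eqmodE _ eqvY_equiv_rel x y.
by split=> [/eqP|/asboolP xy]; [rewrite E => /asboolP|apply/eqP; rewrite E].
Qed.

Lemma RS_eqP (x y : homS) :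
  \pi_RS x = \pi_RS y <-> exists g : SU2, \val y = conj_quad g (\val x).
Proof.
rewrite -[X in X <-> _]/(\pi_({eq_quot eqvS}) x = \pi_({eq_quot eqvS}) y).
have E := @eqmodE _ eqvS_equiv_rel x y.
by split=> [/eqP|/asboolP xy]; [rewrite E => /asboolP|apply/eqP; rewrite E].
Qed.

Fact pillow_subproof (gamma theta : R) :
  quad_rel (qi R, qexpk_i gamma, qexpk_i theta, qexpk_i (theta - gamma)).
Proof.
apply/val_inj; rewrite [LHS]val_SU2M [RHS]val_SU2M !val_qexpk_i cosB sinB /=.
move: (cos2Dsin2 theta).
move: (cos gamma) (sin gamma) (cos theta) (sin theta) => c s c' s' c's'.
congr (_, _, _, _); try by ring.
  by transitivity (- c * (c' ^+ 2 + s' ^+ 2)); [rewrite c's'; ring|ring].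
by transitivity (- s * (c' ^+ 2 + s' ^+ 2)); [rewrite c's'; ring|ring].
Qed.

(* the point of R(S^2, {a, b, c, d}) with pillowcase coordinates (gamma, theta) *)
Definition pillow (gamma theta : R) : RS :=
  \pi_RS (mkhomS (pillow_subproof gamma theta)).

Definition Tcd (x : quadruple) : quadruple :=
  let: (a, b, c, d) := x in (a, b, conjCi (\val c) d, c).
Definition Tbc (x : quadruple) : quadruple :=
  let: (a, b, c, d) := x in (a, conjCi (\val b) c, b, d).
Definition Tcd_inv (x : quadruple) : quadruple :=
  let: (a, b, c, d) := x in (a, b, d, conjCi (\val d)^-1%g c).
Definition Tbc_inv (x : quadruple) : quadruple :=
  let: (a, b, c, d) := x in (a, c, conjCi (\val c)^-1%g b, d).

Lemma conjCi_id (u : Ci) : conjCi (\val u) u = u.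
Proof. by apply/val_inj; rewrite /= mulgK. Qed.
Lemma conjCiK (g : SU2) : cancel (@conjCi R g) (conjCi g^-1%g).
Proof. by move=> u; rewrite -conjCiM mulVg conjCi1. Qed.
Lemma conjCiKV (g : SU2) : cancel (@conjCi R g^-1%g) (conjCi g).
Proof. by move=> u; rewrite -conjCiM mulgV conjCi1. Qed.

Lemma TcdK : cancel Tcd Tcd_inv.
Proof. by move=> [[[a b] c] d]; rewrite /= conjCiK. Qed.
Lemma Tcd_invK : cancel Tcd_inv Tcd.
Proof. by move=> [[[a b] c] d]; rewrite /= conjCiKV. Qed.
Lemma TbcK : cancel Tbc Tbc_inv.
Proof. by move=> [[[a b] c] d]; rewrite /= conjCiK. Qed.
Lemma Tbc_invK : cancel Tbc_inv Tbc.
Proof. by move=> [[[a b] c] d]; rewrite /= conjCiKV. Qed.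

Definition iterz (T : Type) (f finv : T -> T) (n : int) : T -> T :=
  match n with Posz k => iter k f | Negz k => iter k.+1 finv end.

Definition Tcd_pow : int -> quadruple -> quadruple := iterz Tcd Tcd_inv.
Definition Tbc_pow : int -> quadruple -> quadruple := iterz Tbc Tbc_inv.

(* twist [:: a_1; ...; a_m], for odd m, is
   Tcd^(-a_1) \o Tbc^(a_2) \o Tcd^(-a_3) \o ... \o Tbc^(a_(m-1)) \o Tcd^(-a_m) *)
Fixpoint twist (s : seq int) (x : quadruple) : quadruple :=
  match s with
  | [::] => x
  | [:: a1] => Tcd_pow (- a1) x
  | [:: a1, a2 & s'] => Tcd_pow (- a1) (Tbc_pow a2 (twist s' x))
  end.

(* the trivial tangle joins the ends b and c, and the ends a and d *)
Definition trivial_quad (x : pairY) : quadruple := (x.1, x.2, x.2, x.1).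

Lemma iterz_ind (T : Type) (P : T -> Prop) (f finv : T -> T) :
  (forall x, P x -> P (f x)) -> (forall x, P x -> P (finv x)) ->
  forall n x, P x -> P (iterz f finv n x).
Proof.
move=> Pf Pfinv [] n x Px; rewrite /iterz; last first.
  by elim: n.+1 => //= k; exact: Pfinv.
by elim: n => //= k; exact: Pf.
Qed.

Lemma iterz_morph (T : Type) (h f finv : T -> T) :
  {morph h : x / f x} -> {morph h : x / finv x} ->
  forall n, {morph h : x / iterz f finv n x}.
Proof.
move=> hf hfinv [] n x; rewrite /iterz; last first.
  by elim: n.+1 => //= k <-; rewrite hfinv.
by elim: n => //= k <-; rewrite hf.
Qed.

Lemma conj_conjCi (g : SU2) (u v : Ci) :
  conjCi g (conjCi (\val u) v) = conjCi (\val (conjCi g u)) (conjCi g v).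
Proof. by rewrite -!conjCiM /= mulgVK. Qed.

Lemma conj_conjCiV (g : SU2) (u v : Ci) :
  conjCi g (conjCi (\val u)^-1%g v) = conjCi (\val (conjCi g u))^-1%g (conjCi g v).
Proof. by rewrite -!conjCiM /= !invgM invgK mulgA mulgVK. Qed.

Lemma twist_conj (s : seq int) (g : SU2) (x : quadruple) :
  conj_quad g (twist s x) = twist s (conj_quad g x).
Proof.
have cdC n : {morph conj_quad g : x / Tcd_pow n x}.
  by apply: iterz_morph => -[[[a b] c] d] /=; rewrite ?conj_conjCi ?conj_conjCiV.
have bcC n : {morph conj_quad g : x / Tbc_pow n x}.
  by apply: iterz_morph => -[[[a b] c] d] /=; rewrite ?conj_conjCi ?conj_conjCiV.
elim: {s}(size s).+1 {-2}s (ltnSn (size s)) => // n IHn.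
move=> [|a1 [|a2 s]] //= sn; first exact: cdC.
by rewrite cdC bcC IHn// -ltnS ltnW.
Qed.

Lemma sqr_Ci (u v : Ci) : (\val u * \val u = \val v * \val v)%g.
Proof.
have sqr (w : Ci) : \val (\val w * \val w)%g = (-1, 0, 0, 0) :> R * R * R * R.
  move: (CiP w) (SU2P (\val w)) => /=.
  case: (\val (\val w)) => [[[w0 w1] w2] w3]; rewrite /qre /= => -> {w0} <-.
  by congr (_, _, _, _); ring.
by apply/val_inj; rewrite !sqr.
Qed.

Lemma quad_rel_Tcd x : quad_rel x -> quad_rel (Tcd x).
Proof. by case: x => [[[a b] c] d] /= ->; rewrite mulgVK. Qed.

Lemma quad_rel_Tcd_inv x : quad_rel x -> quad_rel (Tcd_inv x).
Proof. by case: x => [[[a b] c] d] /= ->; rewrite invgK !mulgA mulgV mul1g. Qed.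

Lemma quad_rel_Tbc x : quad_rel x -> quad_rel (Tbc x).
Proof.
case: x => [[[a b] c] d] /= bacd.
rewrite -!mulgA; congr (_ * _)%g.
have -> : (\val a = \val b * (\val b * \val b)^-1 * (\val c * \val d))%g.
  by rewrite -bacd invgM !mulgA mulgV mul1g mulVg mul1g.
rewrite (sqr_Ci b c) invgM !mulgA mulgVK.
by rewrite -!mulgA mulKg mulVKg.
Qed.

Lemma quad_rel_Tbc_inv x : quad_rel x -> quad_rel (Tbc_inv x).
Proof.
case: x => [[[a b] c] d] /= bacd; rewrite invgK -!mulgA -bacd !mulgA.
rewrite -[(_ * _ * \val b)%g]mulgA (sqr_Ci b c) !mulgA.
by rewrite mulVg mul1g.
Qed.

Lemma quad_rel_twist (s : seq int) x : quad_rel x -> quad_rel (twist s x).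
Proof.
have cdP n y : quad_rel y -> quad_rel (Tcd_pow n y).
  by apply: iterz_ind => z; [exact: quad_rel_Tcd|exact: quad_rel_Tcd_inv].
have bcP n y : quad_rel y -> quad_rel (Tbc_pow n y).
  by apply: iterz_ind => z; [exact: quad_rel_Tbc|exact: quad_rel_Tbc_inv].
move=> x0; elim: {s}(size s).+1 {-2}s (ltnSn (size s)) => // n IHn.
move=> [|a1 [|a2 s]] //= sn; first exact: cdP.
by apply/cdP/bcP/IHn; rewrite -ltnS ltnW.
Qed.

Fact boundary_subproof (s : seq int) (x : pairY) :
  quad_rel (twist s (trivial_quad x)).
Proof. exact: quad_rel_twist. Qed.

Definition boundary (s : seq int) (x : pairY) : homS :=
  mkhomS (boundary_subproof s x).

(* defined on representatives; [restrictionE] shows it does not depend on them *)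
Definition restriction (s : seq int) (x : RY) : RS :=
  \pi_RS (boundary s (repr x)).

Lemma restrictionE (s : seq int) (x : pairY) :
  restriction s (\pi_RY x) = \pi_RS (boundary s x).
Proof.
apply/RS_eqP; have /RY_eqP[g xE] : \pi_RY (repr (\pi_RY x)) = \pi_RY x.
  by rewrite reprK.
by exists g; rewrite [in LHS]xE [RHS]twist_conj.
Qed.

End RepresentationSpaces.

(* Main.v *)
(* The half twists are invertible operations on quadruples that commute with
   conjugation, so undoing them and keeping the first two entries induces a
   continuous left inverse of the restriction map, which is therefore an
   embedding. Every pair (U, V) is conjugate to exactly one (i, e^(t k) i) with
   t in [0, pi], namely t = acos (- Re (U V)); so R(Y_0, K_0) is an arc. On
   quadruples (i, e^(gamma k) i, e^(theta k) i, e^((theta - gamma) k) i) the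
   half twists act linearly on (gamma, theta): Tcd adds gamma to theta and Tbc
   adds gamma - theta to both. Starting from (t, t) this is the recursion for
   the continued fraction, and its numerator and denominator equal p and q up
   to a common sign, which the pillowcase identification absorbs. *)

From Pilot Require Import Defs.
From mathcomp Require Import all_boot all_order all_algebra ring lra.
From mathcomp Require Import all_classical reals topology normedtype trigo realfun.

Set Implicit Arguments.
Unset Strict Implicit.
Unset Printing Implicit Defensive.

Import Order.TTheory GRing.Theory Num.Theory.
Import numFieldNormedType.Exports.
(* Again, because [Num.Theory] shadows [conjCi]. *)
Import Pilot.Defs.

Local Open Scope classical_set_scope.
Local Open Scope ring_scope.
Local Open Scope quotient_scope.

(** * Continuity of the quaternion operations *)

Section Continuity.

(* [continuous] takes its structures in [nbhsType]; fixing [topologicalType]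
   instances spares the unifier comparisons of neighborhood filters on the
   nested set types in [quadruple]. *)
Definition cmap {X Y : topologicalType} (f : X -> Y) : Prop := continuous f.

Lemma cmap_comp {X Y Z : topologicalType} (f : X -> Y) (g : Y -> Z) :
  cmap f -> cmap g -> cmap (fun x => g (f x)).
Proof. by move=> cf cg x; apply: continuous_comp; [exact: cf|exact: cg]. Qed.

Lemma cmap_id {X : topologicalType} : cmap (fun x : X => x).
Proof. by move=> x; exact: cvg_id. Qed.

Lemma cmap_cst {X Y : topologicalType} (y : Y) : cmap (fun _ : X => y).
Proof. exact: cst_continuous. Qed.

Context {T : topologicalType}.

Lemma cmap_pair {X Y : topologicalType} (f : T -> X) (g : T -> Y) :
  cmap f -> cmap g -> cmap (fun x => (f x, g x)).
Proof. by move=> cf cg x; apply: cvg_pair; [exact: cf|exact: cg]. Qed.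

Lemma cmap_fst {X Y : topologicalType} (f : T -> X * Y) :
  cmap f -> cmap (fun x => (f x).1).
Proof. by move=> cf x; apply: (cvg_comp _ _ (cf x)); exact: cvg_fst. Qed.

Lemma cmap_snd {X Y : topologicalType} (f : T -> X * Y) :
  cmap f -> cmap (fun x => (f x).2).
Proof. by move=> cf x; apply: (cvg_comp _ _ (cf x)); exact: cvg_snd. Qed.

(** Subsets carry the initial topology for [\val], so continuity into [SU2] and [Ci] can be checked
    in real coordinates. *)
Lemma cmap_to_set {X : topologicalType} (A : set X) (f : T -> A) :
  cmap (fun x => \val (f x)) -> cmap f.
Proof. by move=> cf; apply: (@continuous_comp_initial A T X set_val). Qed.

Lemma cmap_val {X : topologicalType} (A : set X) (f : T -> A) :
  cmap f -> cmap (fun x => \val (f x)).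
Proof.
move=> cf x; apply: (cvg_comp _ _ (cf x)).
exact: (@initial_continuous A X set_val).
Qed.

Lemma cmap_add {R : realType} (f g : T -> R) :
  cmap f -> cmap g -> cmap (fun x => f x + g x).
Proof. by move=> cf cg x; apply: cvgD; [exact: cf|exact: cg]. Qed.

Lemma cmap_opp {R : realType} (f : T -> R) :
  cmap f -> cmap (fun x => - f x).
Proof. by move=> cf x; apply: cvgN; exact: cf. Qed.

Lemma cmap_mul {R : realType} (f g : T -> R) :
  cmap f -> cmap g -> cmap (fun x => f x * g x).
Proof. by move=> cf cg x; apply: cvgM; [exact: cf|exact: cg]. Qed.

Context {R : realType}.

Lemma cmap_qmul (f g : T -> R * R * R * R) :
  cmap f -> cmap g -> cmap (fun x => qmul (f x) (g x)).
Proof.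
move=> cf cg.
have [f0 f1 f2 f3] := And4 (cmap_fst (cmap_fst (cmap_fst cf)))
  (cmap_snd (cmap_fst (cmap_fst cf)))
  (cmap_snd (cmap_fst cf)) (cmap_snd cf).
have [g0 g1 g2 g3] := And4 (cmap_fst (cmap_fst (cmap_fst cg)))
  (cmap_snd (cmap_fst (cmap_fst cg)))
  (cmap_snd (cmap_fst cg)) (cmap_snd cg).
(* Projections replace the pattern matching of [qmul], so that the coordinates can be treated one by
   one. *)
have -> : (fun x => qmul (f x) (g x)) = fun x =>
  let y := f x in let z := g x in
  (y.1.1.1 * z.1.1.1 - y.1.1.2 * z.1.1.2 - y.1.2 * z.1.2 - y.2 * z.2,
   y.1.1.1 * z.1.1.2 + y.1.1.2 * z.1.1.1 + y.1.2 * z.2 - y.2 * z.1.2,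
   y.1.1.1 * z.1.2 - y.1.1.2 * z.2 + y.1.2 * z.1.1.1 + y.2 * z.1.1.2,
   y.1.1.1 * z.2 + y.1.1.2 * z.1.2 - y.1.2 * z.1.1.2 + y.2 * z.1.1.1).
  by apply/funext => x; case: (f x) => [[[? ?] ?] ?]; case: (g x) => [[[? ?] ?] ?].
do 3?apply: cmap_pair;
  by do 3?apply: cmap_add; do ?apply: cmap_opp; apply: cmap_mul.
Qed.

Lemma cmap_qconj (f : T -> R * R * R * R) :
  cmap f -> cmap (fun x => qconj (f x)).
Proof.
move=> cf.
have -> : (fun x => qconj (f x)) = fun x =>
    ((f x).1.1.1, - (f x).1.1.2, - (f x).1.2, - (f x).2).
  by apply/funext => x; case: (f x) => [[[? ?] ?] ?].
by do 3?apply: cmap_pair; do ?apply: cmap_opp;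
  do 3?[apply: cmap_fst|apply: cmap_snd].
Qed.

Lemma cmap_mulg (f g : T -> SU2 R) :
  cmap f -> cmap g -> cmap (fun x => f x * g x)%g.
Proof.
by move=> cf cg; apply: cmap_to_set; apply: cmap_qmul;
  apply: cmap_val.
Qed.

Lemma cmap_invg (f : T -> SU2 R) :
  cmap f -> cmap (fun x => (f x)^-1)%g.
Proof.
by move=> cf; apply: cmap_to_set; apply: cmap_qconj;
  apply: cmap_val.
Qed.

Lemma cmap_conjCi (g : T -> SU2 R) (u : T -> Ci R) :
  cmap g -> cmap u -> cmap (fun x => conjCi (g x) (u x)).
Proof.
move=> cg cu; apply: cmap_to_set; apply: cmap_mulg.
  by apply: cmap_mulg => //; exact: cmap_val.
exact: cmap_invg.
Qed.

Lemma cmap_qexpk_i (f : T -> R) :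
  cmap f -> cmap (fun x => qexpk_i (f x)).
Proof.
move=> cf; do 2!apply: cmap_to_set.
have -> : (fun x => \val (\val (qexpk_i (f x)))) =
    fun x => (0, cos (f x), sin (f x), 0).
  by apply/funext => x; rewrite val_qexpk_i.
have cc : cmap (fun x => cos (f x)) by apply: cmap_comp cf _; exact: continuous_cos.
have cs : cmap (fun x => sin (f x)) by apply: cmap_comp cf _; exact: continuous_sin.
have c0 : cmap (fun _ : T => 0 : R) := @cmap_cst T R 0.
exact: (cmap_pair (cmap_pair (cmap_pair c0 cc) cs) c0).
Qed.

End Continuity.

(** * The restriction map as a topological embedding *)

Section Embedding.
Context {R : realType}.

Lemma cmap_twist_generators :
  [/\ cmap (@Tcd R), cmap (@Tcd_inv R),
      cmap (@Tbc R) & cmap (@Tbc_inv R)].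
Proof.
have c_id : cmap (fun x : quadruple R => x) := cmap_id.
have ca := cmap_fst (cmap_fst (cmap_fst c_id)).
have cb := cmap_snd (cmap_fst (cmap_fst c_id)).
have cc := cmap_snd (cmap_fst c_id).
have cd := cmap_snd c_id.
have conj_cts (f g : quadruple R -> Ci R) : cmap f -> cmap g ->
    cmap (fun x => conjCi (\val (f x)) (g x)).
  by move=> cf cg; exact: (cmap_conjCi (cmap_val cf) cg).
have conjV_cts (f g : quadruple R -> Ci R) : cmap f -> cmap g ->
    cmap (fun x => conjCi (\val (f x))^-1%g (g x)).
  move=> cf cg.
  exact: (cmap_conjCi (cmap_invg (cmap_val cf)) cg).
have quad_cts (f0 f1 f2 f3 : quadruple R -> Ci R) : cmap f0 ->
    cmap f1 -> cmap f2 -> cmap f3 ->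
    cmap (fun x => (f0 x, f1 x, f2 x, f3 x) : quadruple R).
  move=> c0 c1 c2 c3.
  exact: (cmap_pair (cmap_pair (cmap_pair c0 c1) c2) c3).
split.
- rewrite (_ : @Tcd R = fun x => (x.1.1.1, x.1.1.2, conjCi (\val x.1.2) x.2, x.1.2)).
    exact: (quad_cts _ _ _ _ ca cb (conj_cts _ _ cc cd) cc).
  by apply/funext => -[[[? ?] ?] ?].
- rewrite (_ : @Tcd_inv R =
      fun x => (x.1.1.1, x.1.1.2, x.2, conjCi (\val x.2)^-1%g x.1.2)).
    exact: (quad_cts _ _ _ _ ca cb cd (conjV_cts _ _ cd cc)).
  by apply/funext => -[[[? ?] ?] ?].
- rewrite (_ : @Tbc R =
      fun x => (x.1.1.1, conjCi (\val x.1.1.2) x.1.2, x.1.1.2, x.2)).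
    exact: (quad_cts _ _ _ _ ca (conj_cts _ _ cb cc) cb cd).
  by apply/funext => -[[[? ?] ?] ?].
- rewrite (_ : @Tbc_inv R =
      fun x => (x.1.1.1, x.1.2, conjCi (\val x.1.2)^-1%g x.1.1.2, x.2)).
    exact: (quad_cts _ _ _ _ ca cc (conjV_cts _ _ cc cb) cd).
  by apply/funext => -[[[? ?] ?] ?].
Qed.

Lemma cmap_iterz (X : topologicalType) (f finv : X -> X) (n : int) :
  cmap f -> cmap finv -> cmap (iterz f finv n).
Proof.
move=> cf cfinv; have c_iter (h : X -> X) k : cmap h -> cmap (iter k h).
  by move=> ch; elim: k => [|k IHk]; [exact: cmap_id|exact: (cmap_comp IHk ch)].
by case: n => k; exact: c_iter.
Qed.

Lemma cmap_Tcd_pow n : cmap (@Tcd_pow R n).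
Proof.
have [cT cTinv _ _] := cmap_twist_generators.
exact: (@cmap_iterz (quadruple R) _ _ n cT cTinv).
Qed.

Lemma cmap_Tbc_pow n : cmap (@Tbc_pow R n).
Proof.
have [_ _ cT cTinv] := cmap_twist_generators.
exact: (@cmap_iterz (quadruple R) _ _ n cT cTinv).
Qed.

Lemma Tcd_pow_conj n (g : SU2 R) x :
  conj_quad g (Tcd_pow n x) = Tcd_pow n (conj_quad g x).
Proof.
by apply: iterz_morph => -[[[a b] c] d] /=; rewrite ?conj_conjCi ?conj_conjCiV.
Qed.

Lemma Tbc_pow_conj n (g : SU2 R) x :
  conj_quad g (Tbc_pow n x) = Tbc_pow n (conj_quad g x).
Proof.
by apply: iterz_morph => -[[[a b] c] d] /=; rewrite ?conj_conjCi ?conj_conjCiV.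
Qed.

Lemma iterzK (X : Type) (f finv : X -> X) (n : int) :
  cancel f finv -> cancel finv f -> cancel (iterz f finv n) (iterz f finv (- n)).
Proof.
have iterK (h hinv : X -> X) k : cancel h hinv -> cancel (iter k h) (iter k hinv).
  by move=> hK; elim: k => // k IHk x; rewrite (iterSr k hinv) (iterS k h) hK IHk.
(* [- Posz k.+1] is [Negz k] and conversely, so each nonzero case undoes [k.+1] iterates of one map
   by as many of the other. *)
move=> fK finvK; case: n => [[|k]|k] x //.
- exact: (iterK _ _ k.+1).
- exact: (iterK _ _ k.+1).
Qed.

Lemma Tcd_powNK n : cancel (@Tcd_pow R (- n)) (Tcd_pow n).
Proof.
by move=> x; have := iterzK (- n) (@TcdK R) (@Tcd_invK R) x; rewrite opprK.
Qed.

Lemma Tbc_powK n : cancel (@Tbc_pow R n) (Tbc_pow (- n)).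
Proof. exact: (iterzK n (@TbcK R) (@Tbc_invK R)). Qed.

(** This is the induction that follows [twist], which consumes two entries at a time. *)
Lemma seq_pair_ind (A : Type) (P : seq A -> Prop) :
  P [::] -> (forall x, P [:: x]) -> (forall x y s, P s -> P [:: x, y & s]) ->
  forall s, P s.
Proof.
move=> P0 P1 P2 s; suff [] : P s /\ forall x, P (x :: s) by [].
by elim: s => // x s [Ps Pxs]; split=> // y; exact: P2.
Qed.

Lemma cmap_twist (s : seq int) : cmap (@twist R s).
Proof.
elim/seq_pair_ind: s => [|a1|a1 a2 s IHs]; first exact: cmap_id.
  exact: cmap_Tcd_pow.
exact: (cmap_comp (cmap_comp IHs (@cmap_Tbc_pow a2)) (@cmap_Tcd_pow (- a1))).
Qed.

(** Equivariance is recorded because it lets [untwist] descend to conjugacy classes. *)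
Lemma twist_invertible (s : seq int) :
  exists untwist : quadruple R -> quadruple R,
    [/\ cancel (twist s) untwist, cmap untwist &
        forall g x, conj_quad g (untwist x) = untwist (conj_quad g x)].
Proof.
elim/seq_pair_ind: s => [|a1|a1 a2 s [untwist [sK cU UJ]]].
- by exists id; split=> //; exact: cmap_id.
- exists (Tcd_pow a1); split; last exact: Tcd_pow_conj.
    exact: Tcd_powNK.
  exact: cmap_Tcd_pow.
- exists (fun x => untwist (Tbc_pow (- a2) (Tcd_pow a1 x))); split.
  + by move=> x /=; rewrite Tcd_powNK Tbc_powK.
  + exact: (cmap_comp (cmap_comp (@cmap_Tcd_pow a1) (@cmap_Tbc_pow (- a2))) cU).
  + by move=> g x; rewrite UJ Tbc_pow_conj Tcd_pow_conj.
Qed.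

Lemma cmap_restriction (s : seq int) : cmap (@restriction R s).
Proof.
have c_id := @cmap_id (pairY R).
have c_trivial : cmap (@trivial_quad R) :=
  cmap_pair (cmap_pair (cmap_pair (cmap_fst c_id) (cmap_snd c_id))
    (cmap_snd c_id)) (cmap_fst c_id).
have c_boundary : cmap (@boundary R s).
  by apply: cmap_to_set; exact: (cmap_comp c_trivial (@cmap_twist s)).
apply: (@repr_comp_continuous _ {eq_quot @eqvY R} _ (\pi_(RS R) \o boundary s)).
  exact: (cmap_comp c_boundary (@pi_continuous _ _)).
move=> x y /eqP xy; apply/eqP => /=.
by rewrite -!restrictionE; congr restriction.
Qed.

Lemma restriction_continuous_retraction (s : seq int) :
  exists2 r : RS R -> RY R, cmap r & cancel (@restriction R s) r.
Proof.
have [untwist [sK cU UJ]] := twist_invertible s.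
pose r0 (x : homS R) : RY R :=
  let y := untwist (\val x) in \pi_(RY R) (y.1.1.1, y.1.1.2).
have r0E x y : \pi_(RS R) x = \pi_(RS R) y -> r0 x = r0 y.
  move=> /RS_eqP[g xyE]; rewrite /r0 xyE -UJ; apply/RY_eqP; exists g.
  by case: (untwist _) => [[[? ?] ?] ?].
exists (r0 \o repr).
  apply: (@repr_comp_continuous _ {eq_quot @eqvS R} _ r0); last first.
    by move=> x y /eqP xy; apply/eqP/r0E.
  have cUv : cmap (fun x : homS R => untwist (\val x)).
    exact: (cmap_comp (cmap_val cmap_id) cU).
  apply: (@cmap_comp _ _ _ (fun x : homS R =>
    ((untwist (\val x)).1.1.1, (untwist (\val x)).1.1.2)) _ _ (@pi_continuous _ _)).
  exact: (cmap_pair (cmap_fst (cmap_fst (cmap_fst cUv)))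
    (cmap_snd (cmap_fst (cmap_fst cUv)))).
move=> x; rewrite -[x]reprK restrictionE /=.
rewrite (r0E _ (boundary s (repr x))) ?reprK//.
by rewrite /r0 /= sK -[RHS]reprK; case: (repr x).
Qed.

Lemma restriction_embedding (s : seq int) : embedding (@restriction R s).
Proof.
have [r cr rK] := restriction_continuous_retraction s.
have /continuousP r_open : continuous r := cr.
split; [exact: cmap_restriction|exact: can_inj rK|move=> U oU].
exists (r @^-1` U); first exact: r_open.
by apply/seteqP; split => x /=; rewrite rK.
Qed.

End Embedding.

(** * Normal form of a pair of pure unit quaternions under conjugation *)

Section NormalForm.
Context {R : realType}.
Local Notation quat := (R * R * R * R)%type.

(** The relation is linear in [x], so it survives division by the norm. One [g] serves all pairs
    [u], [w], so it can fix [i] and move another point at the same time. *)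
Lemma conjCi_of_intertwiner (x : quat) : qnorm2 x != 0 ->
  exists g : SU2 R, forall u w : Ci R,
    qmul x (\val (\val u)) = qmul (\val (\val w)) x -> conjCi g u = w.
Proof.
move=> x0.
have x_ge0 : 0 <= qnorm2 x.
  by case: x {x0} => [[[? ?] ?] ?]; rewrite /= !addr_ge0// sqr_ge0.
pose scale (r : R) (y : quat) : quat := (r * y.1.1.1, r * y.1.1.2, r * y.1.2, r * y.2).
have scaleMl r y z : qmul (scale r y) z = scale r (qmul y z).
  by case: y => [[[? ?] ?] ?]; case: z => [[[? ?] ?] ?]; congr (_, _, _, _) => /=; ring.
have scaleMr r y z : qmul y (scale r z) = scale r (qmul y z).
  by case: y => [[[? ?] ?] ?]; case: z => [[[? ?] ?] ?]; congr (_, _, _, _) => /=; ring.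
have scaleP : qnorm2 (scale (Num.sqrt (qnorm2 x))^-1 x) = 1.
  have <- : (Num.sqrt (qnorm2 x))^-1 ^+ 2 * qnorm2 x = 1.
    by rewrite exprVn sqr_sqrtr// mulVf.
  by move: (_^-1) => r; case: (x) => [[[? ?] ?] ?] /=; ring.
exists (mkSU2 scaleP) => u w xu.
have gu : (mkSU2 scaleP * \val u = \val w * mkSU2 scaleP)%g.
  by apply/val_inj; rewrite [LHS]val_SU2M [RHS]val_SU2M [LHS]scaleMl xu -scaleMr.
by apply/val_inj; rewrite /= gu mulgK.
Qed.

Lemma CiE (u : Ci R) : exists u1 u2 u3 : R,
  \val (\val u) = (0, u1, u2, u3) /\ u1 ^+ 2 + u2 ^+ 2 + u3 ^+ 2 = 1.
Proof.
move: (CiP u) (SU2P (\val u)); case: (\val (\val u)) => [[[u0 u1] u2] u3].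
rewrite /qre /= => -> nu; exists u1, u2, u3; split=> //.
by rewrite -nu; ring.
Qed.

(* The intertwiner is [1 - i u], which vanishes only for [u = - i]. *)
Lemma conjCi_qi_transitive (u : Ci R) : exists g : SU2 R, conjCi g u = qi R.
Proof.
have [u1 [u2 [u3 [uE nu]]]] := CiE u.
have u11 : u1 * u1 = 1 - u2 * u2 - u3 * u3 by lra.
have [u1E|u1N1] := eqVneq (u1 + 1) 0.
  (* Here [u = - i], which conjugation by [j] sends to [i]. *)
  have [|g gP] := @conjCi_of_intertwiner (0, 0, 1, 0).
    by rewrite /= expr0n /= expr1n !add0r addr0 oner_neq0.
  exists g; apply: gP; rewrite uE /=.
  have u1N : u1 = -1 by lra.
  have u20 : u2 = 0 by nra.
  have u30 : u3 = 0 by nra.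
  by rewrite u1N u20 u30; congr (_, _, _, _); ring.
have [|g gP] := @conjCi_of_intertwiner (1 + u1, 0, u3, - u2).
  have -> : qnorm2 (1 + u1, 0, u3, - u2) = 2 * (u1 + 1).
    by rewrite /=; ring: u11.
  by rewrite mulf_neq0// pnatr_eq0.
exists g; apply: gP; rewrite uE /=.
by congr (_, _, _, _); ring: u11.
Qed.

(* The intertwiner is [sin t - j (v2 j + v3 k)], a complex number, which
   therefore commutes with [i]. *)
Lemma conjCi_fix_qi (v : Ci R) (t : R) : 0 <= sin t ->
    (\val (\val v)).1.1.2 = cos t ->
  exists2 g : SU2 R, conjCi g (qi R) = qi R & conjCi g v = qexpk_i t.
Proof.
move=> st_ge0; have [v1 [v2 [v3 [vE nv]]]] := CiE v.
rewrite vE /= => v1E; move: (cos2Dsin2 t) st_ge0; rewrite -v1E.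
set s := sin t => cs st_ge0.
have v23 : v2 ^+ 2 + v3 ^+ 2 = s ^+ 2 by lra.
have v22 : v2 * v2 = s * s - v3 * v3 by lra.
(* This is the squared norm of the intertwiner. When it vanishes, [v2 = - s] and [v3 = 0];
   conjugation by [i] then corrects the sign of the [j] coordinate. *)
have [sv|sv0] := eqVneq (2 * s * (s + v2)) 0.
  have [|g gP] := @conjCi_of_intertwiner (0, 1, 0, 0).
    by rewrite /= expr0n /= expr1n add0r !addr0 oner_neq0.
  have [v2N v30] : v2 = - s /\ v3 = 0.
    move: sv => /eqP; rewrite !mulf_eq0 pnatr_eq0 /= => /orP[/eqP s0|/eqP sv].
      by split; nra.
    by split; nra.
  exists g; apply: gP; first by rewrite /=; congr (_, _, _, _); ring.
  rewrite val_qexpk_i vE -v1E.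
  by rewrite v2N v30 /= -/s; congr (_, _, _, _); ring.
have [|g gP] := @conjCi_of_intertwiner (s + v2, - v3, 0, 0).
  have -> // : qnorm2 (s + v2, - v3, 0, 0) = 2 * s * (s + v2).
  by rewrite /=; ring: v22.
exists g; apply: gP; first by rewrite /=; congr (_, _, _, _); ring.
rewrite val_qexpk_i vE -v1E /= -/s.
by congr (_, _, _, _); ring: v22.
Qed.

(** For pure quaternions, minus the real part of the product is the Euclidean inner product, so this
    is the spherical distance between the two points. *)
Definition angle (x : pairY R) : R := acos (- qre (\val (\val x.1 * \val x.2)%g)).

Lemma angle_conj (g : SU2 R) x : angle (conj_pairY g x) = angle x.
Proof.
rewrite /angle.
have -> : (\val (conj_pairY g x).1 * \val (conj_pairY g x).2 =
           g * (\val x.1 * \val x.2) * g^-1)%g.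
  by rewrite /= !mulgA mulgVK.
by rewrite qre_mulgC mulKg.
Qed.

(** Cauchy-Schwarz for unit vectors: the squared lengths of the difference and the sum are 2 minus
    and 2 plus twice the inner product. *)
Lemma angle_cos_bound (x : pairY R) :
  -1 <= - qre (\val (\val x.1 * \val x.2)%g) <= 1.
Proof.
have [u1 [u2 [u3 [uE nu]]]] := CiE x.1.
have [v1 [v2 [v3 [vE nv]]]] := CiE x.2.
rewrite val_SU2M uE vE /qre /=.
have := sqr_ge0 (u1 - v1); have := sqr_ge0 (u2 - v2); have := sqr_ge0 (u3 - v3).
have := sqr_ge0 (u1 + v1); have := sqr_ge0 (u2 + v2); have := sqr_ge0 (u3 + v3).
by nra.
Qed.

Definition planar_pair (t : R) : pairY R := (qi R, qexpk_i t).

Lemma planar_pair_angle (x : pairY R) :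
  exists g : SU2 R, planar_pair (angle x) = conj_pairY g x.
Proof.
have [g gx] := conjCi_qi_transitive x.1.
have [cosa a0 api] : [/\ cos (angle x) = - qre (\val (\val x.1 * \val x.2)%g),
    0 <= angle x & angle x <= pi].
  by have := angle_cos_bound x; rewrite /angle => xB;
    rewrite acosK ?in_itv//= acos_ge0 ?acos_lepi.
have [||h hi hx] := @conjCi_fix_qi (conjCi g x.2) (angle x).
- by rewrite sin_ge0_pi// a0 api.
- rewrite cosa.
  (* The product is conjugate to that of the pair normalized by [g], whose real part is minus the
     [i] coordinate of [conjCi g x.2]. *)
  have -> : (\val x.1 * \val x.2 =
      g^-1 * (\val (conjCi g x.1) * \val (conjCi g x.2)) * g)%g.
    by rewrite /= !mulgA !mulgVK mulVg mul1g.
  rewrite qre_mulgC mulVKg gx val_SU2M.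
  by case: (\val (\val (conjCi g x.2))) => [[[? ?] ?] ?]; rewrite /qre /=; ring.
by exists (h * g)%g; rewrite conj_pairYM /conj_pairY /= gx hi hx.
Qed.

Lemma angle_planar_pair (t : R) : 0 <= t <= pi -> angle (planar_pair t) = t.
Proof.
move=> t0pi; rewrite /angle val_SU2M val_qexpk_i /qre /=.
rewrite [X in acos X](_ : _ = cos t); last by ring.
by rewrite cosK// in_itv.
Qed.

End NormalForm.

(** * The representation space is an arc *)

Section Arc.
Context {R : realType}.

Lemma acos_within_continuous : {within `[-1, 1], continuous (@acos R)}.
Proof.
(* With endpoints written as [cos pi] and [cos 0], [acos] is the inverse of a continuous function on
   a segment. *)
rewrite -cospi -cos0; apply: segment_can_ge_continuous.
- exact: pi_ge0.
- exact/continuous_subspaceT/continuous_cos.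
- exact: cosK.
Qed.

Lemma cmap_angle : cmap (@angle R).
Proof.
pose c (x : pairY R) : R := - qre (\val (\val x.1 * \val x.2)%g).
have cP x : c x \in `[-1, 1]%classic by rewrite inE/= in_itv /=; exact: angle_cos_bound.
(* Continuity of [acos] is available only within [-1, 1], so the cosine is first corestricted to
   that interval. *)
pose c' (x : pairY R) : (`[-1, 1]%classic : set R) := SigSub (cP x).
have cc : cmap c.
  have c_id := @cmap_id (pairY R).
  apply: cmap_opp.
  exact: (cmap_fst (cmap_fst (cmap_fst (cmap_val (cmap_mulg
    (cmap_val (cmap_fst c_id)) (cmap_val (cmap_snd c_id))))))).
have cc' : cmap c' by exact: cmap_to_set.
have /subspace_sigL_continuousP ca := acos_within_continuous.
exact: (cmap_comp cc' ca).
Qed.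

Definition arc_point (t : (`[0, pi]%classic : set R)) : RY R :=
  \pi_(RY R) (planar_pair (\val t)).

Lemma arc_point_homeomorphism : homeomorphism arc_point.
Proof.
split.
  apply: (@cmap_comp _ _ _ (fun t : (`[0, pi]%classic : set R) =>
    planar_pair (\val t)) _ _ (@pi_continuous _ _)).
  apply: cmap_pair; first exact: cmap_cst.
  exact: (cmap_qexpk_i (cmap_val cmap_id)).
have angleP x : angle x \in `[0, pi : R]%classic.
  rewrite inE/= in_itv/= /angle.
  by have xB := angle_cos_bound x; rewrite acos_ge0 ?acos_lepi.
have angle_pi (x y : pairY R) : \pi_(RY R) x = \pi_(RY R) y -> angle x = angle y.
  by move=> /RY_eqP[g ->]; rewrite angle_conj.
(* The inverse is [angle], which is constant on conjugacy classes and so continuous on the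
   quotient. *)
exists (fun x : RY R => SigSub (angleP (repr x))).
  apply: (@cmap_to_set _ _ _ (fun x : RY R => SigSub (angleP (repr x)))).
  apply: (@repr_comp_continuous _ {eq_quot @eqvY R} _ angle); first exact: cmap_angle.
  by move=> x y /eqP xy; apply/eqP/angle_pi.
split=> [t|x].
  apply/val_inj => /=.
  rewrite (angle_pi _ (planar_pair (\val t))) ?reprK//.
  apply: angle_planar_pair; have := set_mem (valP t).
  by rewrite /= in_itv.
rewrite /arc_point /= -[RHS]reprK; apply/esym/RY_eqP.
exact: planar_pair_angle.
Qed.

Lemma homeomorphism_comp (X Y Z : topologicalType) (f : X -> Y) (g : Y -> Z) :
  homeomorphism f -> homeomorphism g -> homeomorphism (g \o f).
Proof.
move=> [cf [f' cf' [fK f'K]]] [cg [g' cg' [gK g'K]]].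
split; first exact: (cmap_comp cf cg).
exists (f' \o g'); first exact: (cmap_comp cg' cf').
by split; [exact: can_comp|exact: can_comp].
Qed.

Lemma scaling_homeomorphism (b : R) (b_gt0 : 0 < b) :
  exists f : (`[0, 1]%classic : set R) -> (`[0, b]%classic : set R),
    homeomorphism f.
Proof.
have fP (x : (`[0, 1]%classic : set R)) : b * \val x \in `[0, b]%classic.
  have := set_mem (valP x); rewrite inE /= !in_itv /= => /andP[x0 x1].
  by rewrite mulr_ge0 ?(ltW b_gt0)//= ger_pMr.
have gP (x : (`[0, b]%classic : set R)) : b^-1 * \val x \in `[0, 1]%classic.
  have := set_mem (valP x); rewrite inE /= !in_itv /= => /andP[x0 xb].
  by rewrite mulr_ge0 ?invr_ge0 ?(ltW b_gt0)//= mulrC ler_pdivrMr ?mul1r.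
exists (fun x => SigSub (fP x)); split.
  apply: (@cmap_to_set _ _ _ (fun x => SigSub (fP x))).
  exact: (cmap_mul (@cmap_cst _ R b) (cmap_val cmap_id)).
exists (fun x => SigSub (gP x)).
  apply: (@cmap_to_set _ _ _ (fun x => SigSub (gP x))).
  exact: (cmap_mul (@cmap_cst _ R b^-1) (cmap_val cmap_id)).
by split=> x; apply/val_inj => /=; [rewrite mulKf|rewrite mulVKf]; rewrite // gt_eqF.
Qed.

Lemma RY_is_arc : is_arc R (RY R).
Proof.
have [f fH] := @scaling_homeomorphism pi (pi_gt0 R).
exists (arc_point \o f); exact: homeomorphism_comp fH arc_point_homeomorphism.
Qed.

End Arc.

(** * Half twists in pillowcase coordinates and continued fractions *)

Section PlanarQuadruples.
Context {R : realType}.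

Definition planar_quad (gamma theta : R) : quadruple R :=
  (qi R, qexpk_i gamma, qexpk_i theta, qexpk_i (theta - gamma)).

Lemma qexpk_i0 : qexpk_i 0 = qi R.
Proof. by do 2!apply/val_inj; rewrite val_qexpk_i cos0 sin0. Qed.

(** Conjugation by a pure unit quaternion is the half turn about it; on the circle through [i] and
    [j] it reflects the angle [y] in [x]. *)
Lemma conjCi_qexpk_i (x y : R) :
  conjCi (\val (qexpk_i x)) (qexpk_i y) = qexpk_i (2 * x - y).
Proof.
do 2!apply/val_inj.
rewrite [RHS]val_qexpk_i.
transitivity (qmul (qmul (0, cos x, sin x, 0) (0, cos y, sin y, 0))
                   (qconj (0, cos x, sin x, 0))); first by rewrite -!val_qexpk_i.
rewrite cosB sinB mulr_natl mulr2n cosD sinD /=.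
by congr (_, _, _, _); ring.
Qed.

Lemma Tcd_planar (gamma theta : R) :
  Tcd (planar_quad gamma theta) = planar_quad gamma (theta + gamma).
Proof.
rewrite /planar_quad /= conjCi_qexpk_i.
by congr (_, _, qexpk_i _, qexpk_i _); ring.
Qed.

Lemma Tbc_planar (gamma theta : R) :
  Tbc (planar_quad gamma theta) = planar_quad (gamma + (gamma - theta)) gamma.
Proof.
rewrite /planar_quad /= conjCi_qexpk_i.
by congr (_, qexpk_i _, _, qexpk_i _); ring.
Qed.

Lemma iterz_translation (X : Type) (f finv : X -> X) (P : R -> X) (c : R) :
  cancel f finv -> (forall x, f (P x) = P (x + c)) ->
  forall n x, iterz f finv n (P x) = P (x + n%:~R * c).
Proof.
move=> fK fP; have fVP x : finv (P x) = P (x - c).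
  by rewrite -[in LHS](subrK c x) -fP fK.
case=> k x; rewrite /iterz.
  elim: k => [|k IHk]; first by rewrite mul0r addr0.
  by rewrite iterS IHk fP; congr P; rewrite -[in RHS]addn1 PoszD intrD; ring.
elim: k => [|k IHk]; first by rewrite /= fVP NegzE mulN1r.
rewrite iterS IHk fVP; congr P.
by rewrite !NegzE -[in RHS]addn1 PoszD !rmorphN rmorphD /=; ring.
Qed.

Lemma Tcd_pow_planar n (gamma theta : R) :
  Tcd_pow n (planar_quad gamma theta) =
  planar_quad gamma (theta + n%:~R * gamma).
Proof.
exact: (@iterz_translation _ _ _ (planar_quad gamma) gamma (@TcdK R)
  (Tcd_planar gamma)).
Qed.

Lemma Tbc_pow_planar n (gamma theta : R) :
  Tbc_pow n (planar_quad gamma theta) =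
  planar_quad (gamma + n%:~R * (gamma - theta))
              (theta + n%:~R * (gamma - theta)).
Proof.
(* [Tbc] preserves [gamma - theta]; along the line where this difference is fixed it is a
   translation. *)
have TbcP x : Tbc (planar_quad x (x - (gamma - theta))) =
    planar_quad (x + (gamma - theta)) (x + (gamma - theta) - (gamma - theta)).
  by rewrite Tbc_planar; congr planar_quad; ring.
rewrite -[X in planar_quad gamma X](subKr gamma).
rewrite /Tbc_pow (@iterz_translation _ _ _ _ _ (@TbcK R) TbcP).
by congr planar_quad; ring.
Qed.

(* [(p, q)] stands for p/q, with q = 0 for the value [None] of [cfrac]. *)
Fixpoint cfrac_pair (s : seq int) : int * int :=
  if s is a :: s' then
    let: (p, q) := cfrac_pair s' in (a * p + q, p)
  else (1, 0).

Lemma cfrac_pair_coprime s : coprimez (cfrac_pair s).1 (cfrac_pair s).2.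
Proof.
elim: s => [|a s]; first by [].
move=> /=; case: (cfrac_pair s) => p q /= pq.
by rewrite coprimez_sym /coprimez gcdzMDl.
Qed.

(** The recursion is [a + q / p = (a * p + q) / p]. Coprimality excludes the pair (0, 0), so
    vanishing partial denominators are covered too. *)
Lemma cfrac_pairE s : cfrac s = ratinf_frac (cfrac_pair s).1 (cfrac_pair s).2.
Proof.
elim: s => //= a s -> /=; have := cfrac_pair_coprime s.
case: (cfrac_pair s) => p q /=.
rewrite /ratinf_frac; have [->|q0] := eqVneq q 0 => /=.
  have [-> //|p0 _] := eqVneq p 0.
  by rewrite !addr0 rmorphM/= mulfK// intr_eq0.
rewrite mulf_eq0 invr_eq0 !intr_eq0 (negPf q0) orbF => _.
have [//|p0] := eqVneq p 0.
by rewrite /= invf_div rmorphD rmorphM/= mulrDl mulfK// intr_eq0.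
Qed.

(** The invariant is [gamma = q t] and [gamma - theta = p t]. The power [a2] of [Tbc] adds [a2 * p]
    to [q], then the power [- a1] of [Tcd] adds [a1] times the new [q] to [p]: two steps of the
    continued fraction. The start [(t, t)] fits the one-term fraction but not the empty one, whence
    the parity condition. *)
Lemma twist_planar (s : seq int) (t : R) : odd (size s) ->
  twist s (planar_quad t t) =
  planar_quad ((cfrac_pair s).2%:~R * t)
              (((cfrac_pair s).2 - (cfrac_pair s).1)%:~R * t).
Proof.
elim/seq_pair_ind: s => [//|a1 _|a1 a2 s IHs] /=.
  by rewrite Tcd_pow_planar; congr planar_quad;
    rewrite ?intrB ?intrM ?intrD ?mulrNz; ring.
rewrite negbK => /IHs ->; case: (cfrac_pair s) => p q /=.
rewrite Tbc_pow_planar Tcd_pow_planar.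
by congr planar_quad; rewrite !(intrB, intrD, intrM, mulrNz); ring.
Qed.

Lemma restriction_arc_point (s : seq int) t : odd (size s) ->
  restriction s (@arc_point R t) =
  pillow ((cfrac_pair s).2%:~R * \val t)
         (((cfrac_pair s).2 - (cfrac_pair s).1)%:~R * \val t).
Proof.
move=> odd_s; rewrite /arc_point restrictionE; congr (\pi_(RS R) _).
apply/val_inj => /=; rewrite -[RHS]/(planar_quad _ _) -twist_planar//.
(* The trivial tangle gives (i, V, V, i) with V at angle [t], which is the planar quadruple at
   [(t, t)]. *)
by rewrite /trivial_quad /planar_quad /= subrr qexpk_i0.
Qed.

(** Conjugation by [i], the point at angle 0, negates every angle. *)
Lemma pillowN (gamma theta : R) : pillow (- gamma) (- theta) = pillow gamma theta.
Proof.
have conj_qi x : conjCi (\val (qi R)) (qexpk_i x) = qexpk_i (- x).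
  by rewrite -qexpk_i0 conjCi_qexpk_i mulr0 add0r.
apply/esym/RS_eqP; exists (\val (qi R)).
transitivity (conj_quad (\val (qi R)) (planar_quad gamma theta)) => [|//].
rewrite /planar_quad /conj_quad !conj_qi conjCi_id.
by congr (_, _, _, qexpk_i _); ring.
Qed.

End PlanarQuadruples.

(** * Uniqueness of reduced fractions and the conclusion *)

(** Cross-multiplication and coprimality make the numerators divide each other, hence agree up to
    sign; cancelling the nonzero [p] gives the denominators the same sign. *)
Lemma ratinf_frac_inj (p q p' q' : int) : coprimez p q -> coprimez p' q' ->
  p != 0 -> ratinf_frac p q = ratinf_frac p' q' ->
  (p' = p /\ q' = q) \/ (p' = - p /\ q' = - q).
Proof.
move=> pq p'q' p0 E.
have cross : p * q' = p' * q.
  move: E; rewrite /ratinf_frac; have [->|q0] := eqVneq q 0.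
    by have [->|//] := eqVneq q' 0; rewrite !mulr0.
  have [//|q'0] := eqVneq q' 0; move=> [] /eqP.
  by rewrite eqr_div ?intr_eq0// -!intrM eqr_int => /eqP.
have pp' : (p %| p')%Z by rewrite -(Gauss_dvdzl _ pq) -cross dvdz_mulr.
have p'p : (p' %| p)%Z by rewrite -(Gauss_dvdzl _ p'q') cross dvdz_mulr.
have /orP[/eqP pE|/eqP pE] : (p' == p) || (p' == - p).
  by rewrite -real_eqr_norm2 ?num_real// -!abszE eqz_nat eqn_dvd; apply/andP.
- left; split=> //; apply: (mulfI p0); rewrite cross pE //.
- by right; split=> //; apply: (mulfI p0); rewrite cross pE mulrN mulNr.
Qed.

Theorem theorem3 (R : realType) (p q : int) (a : seq int)
    (odd_m : odd (size a))
    (coprime_pq : coprimez p q)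
    (odd_p : odd `|p|%N)
    (pqE : cfrac a = ratinf_frac p q) :
  [/\ is_arc R (RY R),
      embedding (@restriction R a) &
      exists h : (`[0, pi]%classic : set R) -> RY R,
        homeomorphism h /\
        forall t : (`[0, pi]%classic : set R),
          restriction a (h t) =
          pillow (q%:~R * \val t) ((q - p)%:~R * \val t)].
Proof.
split; [exact: RY_is_arc|exact: restriction_embedding|].
exists arc_point; split=> [|t]; first exact: arc_point_homeomorphism.
rewrite restriction_arc_point//.
(* Zero is even, so an odd numerator can be cancelled. *)
have p0 : p != 0 by apply: contraTneq odd_p => ->.
have : ratinf_frac p q = ratinf_frac (cfrac_pair a).1 (cfrac_pair a).2.
  by rewrite -pqE cfrac_pairE.
move=> /(ratinf_frac_inj coprime_pq (cfrac_pair_coprime a) p0)[[-> ->] //|[-> ->]].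
by rewrite -[RHS]pillowN; congr pillow; rewrite -mulNr -rmorphN// opprB opprK addrC.
Qed.
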